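(* Let $m,r\ge 1$ be integers, let $g(t)=\sum_{n\ge 0} g_n\frac{t^n}{n!}$ be a formal power series with $g_0\neq 0$, put $A(t)=1/g(t)$, and let $\{A_n(x)\}_{n\ge 0}$ be the Appell sequence for $g(t)$. Let ${}_{{}_LH^{(m,r)}}A_n(x,y,z)$ $(n\ge 0)$ be the Laguerre-Gould Hopper based Appell polynomials, i.e. ${}_{{}_LH^{(m,r)}}A_n(x,y,z)=A_n(\hat M_{LH})\{1\}$. Then they have the generating function $$\frac{1}{g(t)}\,C_0(-xt^m)\exp(yt+zt^r)=\sum_{n=0}^{\infty}{}_{{}_LH^{(m,r)}}A_n(x,y,z)\,\frac{t^n}{n!},$$ or, equivalently, $$A(t)\,C_0(-xt^m)\exp(yt+zt^r)=\sum_{n=0}^{\infty}{}_{{}_LH^{(m,r)}}A_n(x,y,z)\,\frac{t^n}{n!},$$ as identities of formal power series in $t$.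
   Context: Coefficients are real (or complex) numbers. The Appell sequence for $g(t)$ is the sequence of polynomials $A_n(x)$ defined by $\frac{1}{g(t)}e^{xt}=\sum_{n\ge0}A_n(x)\frac{t^n}{n!}$. $C_0$ is the Bessel-Tricomi function of order zero, $C_0(x)=\sum_{k\ge0}\frac{(-1)^k x^k}{(k!)^2}$, so $C_0(-xt^m)=\sum_{k\ge 0}\frac{x^kt^{mk}}{(k!)^2}$. $D_x^{-1}$ is the inverse derivative operator acting on polynomials in $x$ (linearly over the other variables) by $D_x^{-1}\{x^k\}=\frac{x^{k+1}}{k+1}$; in particular $D_x^{-n}\{1\}=\frac{x^n}{n!}$. $\hat M_{LH}$ is the linear operator on polynomials in $x,y,z$ $$\hat M_{LH}=y+mD_x^{-1}\frac{\partial^{m-1}}{\partial y^{m-1}}+rz\frac{\partial^{r-1}}{\partial y^{r-1}},$$ where $y$ and $z$ act by multiplication. For a polynomial $p$, $p(\hat M_{LH})\{1\}$ denotes the result of applying the operator $p(\hat M_{LH})$ to the constant polynomial $1$. *)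

(* Defs.v *)
From HB Require Import structures.
From mathcomp Require Import all_boot all_order all_algebra.
From mathcomp Require Import mpoly.

Set Implicit Arguments.
Unset Strict Implicit.
Unset Printing Implicit Defensive.

Import Order.TTheory GRing.Theory Num.Theory.
Local Open Scope ring_scope.

(** A formal power series in t is the function giving its coefficients;
    identities of series are pointwise equalities [=1]. *)
Definition fps (T : Type) : Type := nat -> T.

Section Series.
Variable S : nzRingType.
Implicit Types f h : fps S.

Definition fps_one : fps S := fun n => (n == 0)%:R.
Definition fps_mono (a : S) (j : nat) : fps S := fun n => if n == j then a else 0.
Definition fps_add f h : fps S := fun n => f n + h n.
Definition fps_mul f h : fps S := fun n => \sum_(i < n.+1) f i * h (n - i)%N.
Definition fps_exp f (k : nat) : fps S := iter k (fps_mul f) fps_one.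
End Series.

Section Inverse.
Variable K : fieldType.
Implicit Types f : fps K.

(* The first n.+1 coefficients of 1/f. *)
Fixpoint fps_inv_seq f (n : nat) : seq K :=
  if n is p.+1 then
    let s := fps_inv_seq f p in
    rcons s (- (f 0)^-1 * \sum_(i < n) f (n - i)%N * s`_i)
  else [:: (f 0)^-1].

(* 1/f, meaningful when f 0 != 0; see [fps_mulfV]. *)
Definition fps_inv f : fps K := fun n => (fps_inv_seq f n)`_n.

Lemma size_fps_inv_seq f n : size (fps_inv_seq f n) = n.+1.
Proof. by elim: n => //= n IHn; rewrite size_rcons IHn. Qed.

Lemma nth_fps_inv_seq f n i : (i <= n)%N -> (fps_inv_seq f n)`_i = fps_inv f i.
Proof.
elim: n => [|n IHn]; first by rewrite leqn0 => /eqP->.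
rewrite leq_eqVlt => /orP[/eqP-> //|lt_in].
by rewrite /= nth_rcons size_fps_inv_seq lt_in IHn.
Qed.

Lemma fps_mulfV f : f 0 != 0 -> fps_mul f (fps_inv f) =1 fps_one K.
Proof.
move=> f0 [|n]; rewrite /fps_mul /fps_one /=.
  by rewrite big_ord1 /fps_inv /= mulfV.
rewrite big_ord_recl /= subn0 {1}/fps_inv /= nth_rcons size_fps_inv_seq.
rewrite ltnn eqxx mulrA mulrN mulfV // mulN1r.
apply/eqP; rewrite addrC subr_eq0 [X in _ == X](reindex_inj rev_ord_inj).
apply/eqP/eq_bigr => i _ /=; have le_in : (i <= n)%N by rewrite -ltnS.
rewrite !subSS nth_fps_inv_seq ?leq_subr //.
by rewrite subSn ?leq_subr // subKn.
Qed.
End Inverse.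

Section Algebra.
Variable R : numFieldType.

(* The series \sum_n a_n t^n / n!. *)
Definition egf (V : lmodType R) (a : nat -> V) : fps V :=
  fun n => (n`!%:R)^-1 *: a n.

(* The series g(t) = \sum_n g_n t^n / n! with scalar coefficients. *)
Definition scalar_egf (g : nat -> R) : fps R := fun n => g n / n`!%:R.

Variable S : comAlgType R.

(* Scalar series seen as a series over the R-algebra S. *)
Definition fps_lift (f : fps R) : fps S := fun n => (f n)%:A.

(* The composite \sum_k c_k f^k for a series f with f 0 = 0: the terms k > n do
   not contribute to the coefficient of t^n. Not meaningful if f 0 != 0. *)
Definition fps_comp (c : fps R) (f : fps S) : fps S :=
  fun n => \sum_(k < n.+1) c k *: fps_exp f k n.

Definition exp_ser : fps R := fun k => (k`!%:R)^-1.

Definition C0_ser : fps R := fun k => (-1) ^+ k / (k`!%:R) ^+ 2.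
End Algebra.

(* (1 / g(t)) e^(xt) = \sum_n A_n(x) t^n / n!, which determines A_. *)
Definition is_appell (R : numFieldType) (g : nat -> R)
    (A_ : nat -> {poly R}) : Prop :=
  fps_mul (fps_lift {poly R} (fps_inv (scalar_egf g)))
          (fps_comp (exp_ser R) (fps_mono 'X 1))
  =1 egf A_.

Lemma is_appell_exists (R : numFieldType) (g : nat -> R) :
  exists A_, is_appell g A_.
Proof.
exists (fun n => n`!%:R *: fps_mul
  (fps_lift {poly R} (fps_inv (scalar_egf g)))
  (fps_comp (exp_ser R) (fps_mono 'X 1)) n) => n.
by rewrite /egf scalerA mulVf ?scale1r // pnatr_eq0 -lt0n fact_gt0.
Qed.

(* The variables x, y, z are those of index 0, 1, 2 of {mpoly R[3]}. *)
Definition ix : 'I_3 := @Ordinal 3 0 isT.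
Definition iy : 'I_3 := @Ordinal 3 1 isT.
Definition iz : 'I_3 := @Ordinal 3 2 isT.

Section Operator.
Variable R : numFieldType.
Implicit Types p : {mpoly R[3]}.

(* x^a y^b z^c |-> x^(a+1) y^b z^c / (a+1), extended linearly. *)
Definition Dxinv p : {mpoly R[3]} :=
  \sum_(k <- msupp p) (p@_k / (k ix).+1%:R) *: 'X_[(k + U_(ix))%MM].

Lemma DxinvX k : Dxinv 'X_[k] = ((k ix).+1%:R)^-1 *: 'X_[(k + U_(ix))%MM].
Proof. by rewrite /Dxinv msuppX big_seq1 mcoeffX eqxx mul1r. Qed.

Lemma mderiv_Dxinv p : mderiv ix (Dxinv p) = p.
Proof.
rewrite /Dxinv linear_sum /= [RHS]mpolyE; apply: eq_bigr => k _.
rewrite linearZ /= mderivX scalerA addmK mnmDE mnm1E eqxx addn1.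
by rewrite divfK ?pnatr_eq0.
Qed.

Definition dy (j : nat) p : {mpoly R[3]} := iter j (mderiv iy) p.

Definition M_LH (m r : nat) p : {mpoly R[3]} :=
  'X_iy * p + m%:R *: Dxinv (dy m.-1 p) + r%:R *: ('X_iz * dy r.-1 p).

(* q(M) applied to p, where q(M) = \sum_i q_i M^i. *)
Definition poly_op (q : {poly R}) (M : {mpoly R[3]} -> {mpoly R[3]}) p
    : {mpoly R[3]} :=
  \sum_(i < size q) q`_i *: iter i M p.

Definition LGH_appell (m r : nat) (A_ : nat -> {poly R}) (n : nat)
    : {mpoly R[3]} :=
  poly_op (A_ n) (M_LH m r) 1.

(* C_0(-x t^m). *)
Definition C0_xt (m : nat) : fps {mpoly R[3]} :=
  fps_comp (C0_ser R) (fps_mono (- 'X_ix) m).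

(* exp(y t + z t^r). *)
Definition exp_yt_zt (r : nat) : fps {mpoly R[3]} :=
  fps_comp (exp_ser R) (fps_add (fps_mono 'X_iy 1) (fps_mono 'X_iz r)).
End Operator.

(* Main.v *)
(** Let [C = C_0(-x t^m)], [E = exp(y t + z t^r)] and let [M] be the operator of
    the theorem. Differentiating in [t] gives [C' = m t^(m-1) Dx^-1 C] and
    [E' = (y + r z t^(r-1)) E]. Moreover multiplication of [E] by [t] is
    differentiation in [y], while [C] does not depend on [y] and [E] does not
    depend on [x], so that [(C E)' = M (C E)]. Hence
    [M^n 1 = n! [t^n] (C E)], and the theorem follows by expanding [A_n] on the
    monomial basis. *)
From HB Require Import structures.
Require Import Defs.
From mathcomp Require Import all_boot all_order all_algebra.
From mathcomp Require Import mpoly ring.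
Import GRing.Theory Num.Theory.
Local Open Scope ring_scope.

Set Implicit Arguments.
Unset Strict Implicit.
Unset Printing Implicit Defensive.

(** * Formal power series compared with their polynomial truncations *)

Section SeriesOperations.
Variable S : comNzRingType.
Implicit Types (f h : fps S) (p q : {poly S}).

Definition fps_deriv f : fps S := fun n => f n.+1 *+ n.+1.

(* Multiplication by t^d. *)
Definition fps_shift (d : nat) f : fps S :=
  fun n => if (n < d)%N then 0 else f (n - d)%N.

Lemma eq_fps_mul f1 f2 h1 h2 :
  f1 =1 f2 -> h1 =1 h2 -> fps_mul f1 h1 =1 fps_mul f2 h2.
Proof. by move=> eq_f eq_h n; apply: eq_bigr => i _; rewrite eq_f eq_h. Qed.

(** The coefficient of t^n in a product only sees coefficients of index at most n. Series can thus
    be replaced by truncations, and identities of [{poly S}] carry over. *)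
Lemma fps_mul_coef f h p q n :
    (forall i, (i <= n)%N -> f i = p`_i) ->
    (forall i, (i <= n)%N -> h i = q`_i) ->
  fps_mul f h n = (p * q)`_n.
Proof.
move=> fp hq; rewrite coefM; apply: eq_bigr => i _.
by rewrite fp -1?ltnS // hq ?leq_subr.
Qed.

Lemma fps_exp_coef f p k n :
  (forall i, (i <= n)%N -> f i = p`_i) -> fps_exp f k n = (p ^+ k)`_n.
Proof.
elim: k n => [|k IHk] n fp; first by rewrite expr0 coef1.
rewrite exprS; apply: fps_mul_coef => // i le_in.
by apply: IHk => j le_ji; apply/fp/(leq_trans le_ji).
Qed.

Lemma fps_exp_eq0 f k n : f 0 = 0 -> (n < k)%N -> fps_exp f k n = 0.
Proof.
move=> f0; elim: k n => // k IHk n lt_nk; rewrite /= /fps_mul.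
apply: big1 => -[[|i] lt_in] _ /=; first by rewrite f0 mul0r.
rewrite -/(fps_exp f k _) IHk ?mulr0 //; case: n lt_nk lt_in => // n lt_nk _.
by rewrite subSS (leq_ltn_trans (leq_subr _ _)).
Qed.

Lemma trunc_coef f n i : (i <= n)%N -> f i = (\poly_(j < n.+1) f j)`_i.
Proof. by rewrite coef_poly ltnS => ->. Qed.

Lemma fps_shiftD d e f : fps_shift d (fps_shift e f) =1 fps_shift (d + e) f.
Proof.
move=> n; rewrite /fps_shift; case: ltnP => [lt_nd | le_dn].
  by rewrite ltn_addr.
by rewrite -[X in (X < d + e)%N](subnKC le_dn) ltn_add2l subnDA.
Qed.

Lemma fps_mul_shiftC d f h :
  fps_mul (fps_shift d f) h =1 fps_mul f (fps_shift d h).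
Proof.
move=> n; pose p := \poly_(j < n.+1) f j; pose q := \poly_(j < n.+1) h j.
rewrite (@fps_mul_coef _ _ ('X^d * p) q) ?(@fps_mul_coef f _ p ('X^d * q)).
- by rewrite mulrCA mulrA.
- exact: trunc_coef.
- move=> i le_in; rewrite coefXnM -trunc_coef //.
  exact: leq_trans (leq_subr _ _) le_in.
- move=> i le_in; rewrite coefXnM -trunc_coef //.
  exact: leq_trans (leq_subr _ _) le_in.
- exact: trunc_coef.
Qed.

Lemma fps_deriv_mul f h n :
  fps_deriv (fps_mul f h) n =
  fps_mul (fps_deriv f) h n + fps_mul f (fps_deriv h) n.
Proof.
(* The derivative at n uses coefficient n+1, hence truncation after n+2 terms. *)
pose p := \poly_(j < n.+2) f j; pose q := \poly_(j < n.+2) h j.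
have pE := @trunc_coef f n.+1; have qE := @trunc_coef h n.+1.
rewrite /fps_deriv (fps_mul_coef pE qE) -coef_deriv derivM coefD.
congr (_ + _); apply/esym/fps_mul_coef => i le_in.
- by rewrite coef_deriv -pE.
- by rewrite -qE // ltnW.
- by rewrite -pE // ltnW.
- by rewrite coef_deriv -qE.
Qed.

Lemma fps_mul_mono (a : S) d h n :
  fps_mul (fps_mono a d) h n = a * fps_shift d h n.
Proof.
rewrite /fps_mul /fps_shift; case: ltnP => [lt_nd | le_dn].
  rewrite mulr0 big1 // => i _; rewrite /fps_mono.
  by rewrite ltn_eqF ?mul0r // (leq_ltn_trans _ lt_nd) // -ltnS.
rewrite (bigD1 (Ordinal (le_dn : (d < n.+1)%N))) //= /fps_mono eqxx big1 ?addr0 //.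
by move=> i /negbTE; rewrite -val_eqE /= => ->; rewrite mul0r.
Qed.

Lemma fps_exp_mono (a : S) d k :
  fps_exp (fps_mono a d) k =1 fps_mono (a ^+ k) (d * k).
Proof.
elim: k => [|k IHk] n; first by rewrite muln0 /fps_mono /= /fps_one; case: eqP.
rewrite /= -/(fps_exp _ k) fps_mul_mono /fps_shift IHk /fps_mono exprS mulnS.
case: ltnP => [lt_nd | le_dn].
  by rewrite mulr0 ltn_eqF // ltn_addr.
rewrite -{2}(subnKC le_dn) eqn_add2l.
by case: eqP; rewrite ?mulr0.
Qed.
End SeriesOperations.

(** * Composition with the exponential series *)

Section Exponential.
Variables (R : numFieldType) (S : comAlgType R).
Implicit Types f : fps S.

(** Powers f^k with k > n start beyond t^n. A common bound [N] makes one finite sum serve all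
    coefficients below it. *)
Lemma fps_comp_wide (c : fps R) f n N : f 0 = 0 -> (n < N)%N ->
  fps_comp c f n = \sum_(k < N) c k *: fps_exp f k n.
Proof.
move=> f0 lt_nN; rewrite /fps_comp (big_ord_widen N (fun k => c k *: fps_exp f k n)) //.
rewrite [RHS](bigID (fun k : 'I_N => (k < n.+1)%N)) /= [X in _ + X]big1 ?addr0 //.
by move=> k; rewrite -leqNgt => lt_nk; rewrite fps_exp_eq0 ?scaler0.
Qed.

(** The chain rule, term by term: the derivative of f^(k+1)/(k+1)! is f' f^k/k!. *)
Lemma fps_deriv_exp_ser f : f 0 = 0 ->
  fps_deriv (fps_comp (exp_ser R) f) =1
  fps_mul (fps_deriv f) (fps_comp (exp_ser R) f).
Proof.
move=> f0 n; pose p := \poly_(j < n.+2) f j.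
have pE := @trunc_coef _ f n.+1.
(* [Q] is the truncated exponential of [p]; it agrees with exp(f) up to t^n. *)
pose Q : {poly S} := \sum_(k < n.+1) ((exp_ser R k)%:A : S)%:P * p ^+ k.
rewrite (@fps_mul_coef _ _ _ p^`() Q); first last.
- move=> i le_in; rewrite (@fps_comp_wide _ _ _ n.+1) // coef_sum.
  apply: eq_bigr => k _; rewrite coefCM mulr_algl; congr (_ *: _).
  by apply: fps_exp_coef => j le_ji; apply/pE/leqW/(leq_trans le_ji).
- by move=> i le_in; rewrite coef_deriv -pE.
rewrite /fps_deriv /fps_comp -sumrMnl big_ord_recl.
rewrite [X in X + _](_ : _ = 0); last first.
  by rewrite /= /fps_one scaler0 mul0rn.
rewrite add0r /Q mulr_sumr coef_sum; apply: eq_bigr => k _.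
rewrite (@fps_exp_coef _ _ p); last exact: pE.
rewrite scalerMnr -coef_deriv deriv_exp /= coefMn mulrCA coefCM mulr_algl.
rewrite -scaler_nat scalerA; congr (_ *: _).
rewrite /exp_ser /bump /= add1n factS natrM invfM mulrAC mulVf ?mul1r //.
by rewrite pnatr_eq0.
Qed.
End Exponential.

(** * Linearity of Dx^-1, and the factors that commute with it *)

Section InverseDerivative.
Variable R : numFieldType.
Implicit Types p q : {mpoly R[3]}.

(** [Dxinv] sums over the support of its argument, which hides linearity; this formula exposes it.
    Monomials without x never occur in the image; the other coefficients are recovered by
    differentiating in x. *)
Lemma mcoeff_Dxinv p k :
  (Dxinv p)@_k = if k ix is j.+1 then p@_(k - U_(ix)) / j.+1%:R else 0.
Proof.
case def_j: (k ix) => [|j].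
  rewrite /Dxinv raddf_sum /= big1 // => l _; rewrite mcoeffZ mcoeffX.
  case: eqP => [def_k|_]; last by rewrite mulr0.
  by move: def_j; rewrite -def_k mnmDE mnm1E eqxx addn1.
have le_Uk : (U_(ix) <= k)%MM by rewrite lep1mP def_j.
rewrite -[in RHS](mderiv_Dxinv p) mcoeff_deriv submK //.
by rewrite mnmBE mnm1E eqxx def_j subn1 /= -[X in X / _]mulr_natr mulfK ?pnatr_eq0.
Qed.

Lemma Dxinv_is_linear : linear (@Dxinv R).
Proof.
move=> a p q; apply/mpolyP => k; rewrite mcoeffD mcoeffZ !mcoeff_Dxinv.
case: (k ix) => [|j]; first by rewrite mulr0 addr0.
by rewrite mcoeffD mcoeffZ mulrDl mulrA.
Qed.

HB.instance Definition _ :=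
  GRing.isLinear.Build R {mpoly R[3]} {mpoly R[3]} _ (@Dxinv R) Dxinv_is_linear.

(* [q] does not involve [x]. *)
Definition Dxinv_const q := forall p, Dxinv (p * q) = Dxinv p * q.

Lemma Dxinv_constX (k : 'X_{1..3}) : k ix = 0 -> Dxinv_const 'X_[k].
Proof.
move=> k0; elim/mpolyind => [|c l p _ _ IHp]; first by rewrite !(mul0r, linear0).
rewrite mulrDl linearD /= IHp linearD /= mulrDl -scalerAl !linearZ /= -mpolyXD.
rewrite !DxinvX mnmDE k0 addn0 -!scalerAl -mpolyXD.
by rewrite -!addmA [(k + _)%MM]addmC.
Qed.

Lemma Dxinv_constM q1 q2 :
  Dxinv_const q1 -> Dxinv_const q2 -> Dxinv_const (q1 * q2).
Proof. by move=> c1 c2 p; rewrite mulrA c2 c1 mulrA. Qed.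

Lemma Dxinv_constD q1 q2 :
  Dxinv_const q1 -> Dxinv_const q2 -> Dxinv_const (q1 + q2).
Proof. by move=> c1 c2 p; rewrite !mulrDr linearD /= c1 c2. Qed.

Lemma Dxinv_constZ a q : Dxinv_const q -> Dxinv_const (a *: q).
Proof. by move=> cq p; rewrite -!scalerAr linearZ /= cq. Qed.
End InverseDerivative.

(** * The factors exp(y t + z t^r) and C_0(-x t^m) *)

Section GeneratingFunction.
Variable R : numFieldType.
Implicit Types m r : nat.

Local Notation x := ('X_ix : {mpoly R[3]}).
Local Notation y := ('X_iy : {mpoly R[3]}).
Local Notation z := ('X_iz : {mpoly R[3]}).
Local Notation E := (exp_yt_zt R).
Local Notation C := (C0_xt R).

Lemma fps_deriv_exp_yt_zt r : (0 < r)%N ->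
  fps_deriv (E r) =1 fun n => y * E r n + r%:R *: (z * fps_shift r.-1 (E r) n).
Proof.
case: r => // r _ n; rewrite /exp_yt_zt fps_deriv_exp_ser; last first.
  by rewrite /fps_add /fps_mono addr0.
set e := fps_comp _ _.
(* The inner derivative is y + (r+1) z t^r, [r] having been replaced by its successor. *)
have -> : fps_mul (fps_deriv (fps_add (fps_mono y 1) (fps_mono z r.+1))) e n
    = fps_mul (fps_mono y 0) e n + fps_mul (fps_mono (r.+1%:R *: z) r) e n.
  rewrite -big_split /=; apply: eq_bigr => i _; rewrite -mulrDl; congr (_ * _).
  rewrite /fps_deriv /fps_add /fps_mono !eqSS mulrnDl; congr (_ + _).
    by case: eqP => [->|_]; rewrite ?mul0rn.
  by case: eqP => [->|_]; rewrite ?mul0rn // scaler_nat.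
by rewrite !fps_mul_mono /fps_shift ltn0 subn0 scalerAl.
Qed.

Lemma exp_yt_zt0 r : E r 0 = 1.
Proof. by rewrite /exp_yt_zt /fps_comp big_ord1 /exp_ser invr1 scale1r. Qed.

(** The differential equation read as a recurrence, on which strong inductions on the coefficient
    index can run. *)
Lemma exp_yt_ztS r n : (0 < r)%N ->
  E r n.+1 = n.+1%:R^-1 *: (y * E r n + r%:R *: (z * fps_shift r.-1 (E r) n)).
Proof.
move=> r_gt0; rewrite -fps_deriv_exp_yt_zt // /fps_deriv -scaler_nat scalerA.
by rewrite mulVf ?scale1r ?pnatr_eq0.
Qed.

Lemma fps_shift_ind (V : comNzRingType) d (f : fps V) (P : V -> Prop) n :
  P 0 -> (forall i, (i <= n)%N -> P (f i)) -> P (fps_shift d f n).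
Proof.
by move=> P0 Pf; rewrite /fps_shift; case: ifP => // _; apply/Pf/leq_subr.
Qed.

Lemma Dxinv_const_exp_yt_zt r n : (0 < r)%N -> Dxinv_const (E r n).
Proof.
move=> r_gt0; elim/ltn_ind: n => -[|n] IHn.
  by move=> p; rewrite exp_yt_zt0 !mulr1.
have cX i : i != ix -> Dxinv_const ('X_i : {mpoly R[3]}).
  by move=> neq_i; apply: Dxinv_constX; rewrite mnm1E (negbTE neq_i).
rewrite exp_yt_ztS //; apply/Dxinv_constZ/Dxinv_constD.
  by apply: Dxinv_constM; [apply: cX | apply: IHn].
apply/Dxinv_constZ/Dxinv_constM; first exact: cX.
apply: fps_shift_ind => [p|i le_in]; first by rewrite !mulr0 linear0.
exact: IHn.
Qed.

(* Differentiating the recurrence [exp_yt_ztS] for [E_(n+1)] and using the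
   induction hypothesis gives [E_n] plus the recurrence for [n E_n]. *)
Lemma mderiv_exp_yt_zt r n : (0 < r)%N ->
  mderiv iy (E r n) = fps_shift 1 (E r) n.
Proof.
move=> r_gt0; elim/ltn_ind: n => -[|n] IHn.
  by rewrite exp_yt_zt0 -mpolyC1 mderivC.
have shiftE : mderiv iy (fps_shift r.-1 (E r) n)
            = fps_shift r.-1 (fps_shift 1 (E r)) n.
  rewrite /fps_shift; case: ltnP => [_|le_rn]; first exact: mderiv0.
  by rewrite IHn // ltnS leq_subr.
rewrite exp_yt_ztS // mderivZ mderivD mderivZ !mderivM IHn // shiftE.
have dX i : mderiv iy ('X_i : {mpoly R[3]}) = (i == iy)%:R.
  rewrite mderivX mnm1E; case: eqP => [->|_]; last by rewrite scale0r.
  by rewrite scale1r -[X in (X - _)%MM]add0m addmK mpolyX0.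
rewrite !dX /= mul1r mul0r add0r [fps_shift _ _ n.+1]/fps_shift /= subn1 /= -addrA.
rewrite fps_shiftD addnC -fps_shiftD.
have -> : y * fps_shift 1 (E r) n
          + r%:R *: (z * fps_shift 1 (fps_shift r.-1 (E r)) n) = n%:R *: E r n.
  case: n {IHn shiftE} => [|n].
    by rewrite /fps_shift /= !mulr0 scaler0 addr0 scale0r.
  rewrite /fps_shift /= !subn1 /= exp_yt_ztS // scalerA mulfV ?scale1r //.
  by rewrite pnatr_eq0.
by rewrite -{1}[E r n]scale1r -scalerDl nat1r scalerA mulVf ?scale1r ?pnatr_eq0.
Qed.

(** The signs of C_0 and of (-x)^k cancel. At most one term survives; keeping the sum avoids
    deciding whether m divides n. *)
Lemma C0_xt_wide m n N : (0 < m)%N -> (n < N)%N ->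
  C m n = \sum_(k < N) (if n == (m * k)%N
                        then (k`!%:R ^+ 2)^-1 *: 'X_[U_(ix) *+ k] else 0).
Proof.
case: m => // m _ lt_nN; rewrite /C0_xt (@fps_comp_wide _ _ _ _ _ N) //.
apply: eq_bigr => k _; rewrite fps_exp_mono /fps_mono.
case: eqP => _; rewrite ?scaler0 // -scaleN1r exprZn mpolyXn /C0_ser.
by rewrite scalerA mulrAC -exprMn mulrNN mulr1 expr1n mul1r.
Qed.

(** Term k+1 on the left matches term k on the right: m (k+1) x^(k+1)/((k+1)!)^2 is m times Dx^-1 of
    x^k/(k!)^2. *)
Lemma fps_deriv_C0_xt m n : (0 < m)%N ->
  fps_deriv (C m) n = m%:R *: Dxinv (fps_shift m.-1 (C m) n).
Proof.
case: m => // m _; rewrite /fps_deriv (@C0_xt_wide _ _ n.+2) // big_ord_recl.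
(* Below the shift both sides vanish: n+1 is smaller than every positive multiple of the
   exponent. *)
rewrite muln0 /= add0r /fps_shift; case: ltnP => [lt_nm | le_mn].
  rewrite linear0 scaler0 big1 ?mul0rn // => k _; rewrite ltn_eqF //.
  by rewrite (leq_trans (_ : n.+1 < m.+1)%N) // leq_pmulr.
rewrite (@C0_xt_wide _ (n - m) n.+1) ?ltnS ?leq_subr //.
rewrite (raddf_sum (@Dxinv R)) /= scaler_sumr.
rewrite -sumrMnl; apply: eq_bigr => k _; rewrite /bump /= add1n.
rewrite mulnS addSn eqSS -{1}(subnKC le_mn) eqn_add2l.
case: eqP => [eq_n|_]; last by rewrite mul0rn linear0 scaler0.
rewrite linearZ /= DxinvX mulmnE mnm1E eqxx mul1n -scaler_nat !scalerA.
rewrite -mulmSr; congr (_ *: _).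
rewrite [X in X%:R / _ = _](_ : n.+1 = m.+1 * k.+1)%N; last first.
  by rewrite mulnS addSn -eq_n subnKC.
rewrite natrM factS natrM exprMn.
have [k1 kf] : k.+1%:R != 0 :> R /\ k`!%:R != 0 :> R.
  by rewrite !pnatr_eq0 -!lt0n fact_gt0.
by field; rewrite nat1r k1 kf.
Qed.

Lemma mderiv_C0_xt m n : (0 < m)%N -> mderiv iy (C m n) = 0.
Proof.
move=> m_gt0; rewrite (C0_xt_wide m_gt0 (ltnSn n)) linear_sum big1 // => k _.
case: ifP => _; last exact: linear0.
by rewrite linearZ /= mderivX mulmnE mnm1E /= mul0n scale0r scaler0.
Qed.

(** * The operator [M_LH] acting on the product of the two factors *)

Lemma dy_fps_mul m r j n : (0 < m)%N -> (0 < r)%N ->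
  dy j (fps_mul (C m) (E r) n) = fps_mul (C m) (fps_shift j (E r)) n.
Proof.
move=> m_gt0 r_gt0; elim: j n => [|j IHj] n.
  by apply: eq_bigr => i _; rewrite /fps_shift subn0.
rewrite /dy iterS -/(dy j _) IHj linear_sum; apply: eq_bigr => i _ /=.
rewrite mderivM mderiv_C0_xt // mul0r add0r; congr (_ * _).
rewrite -(addn1 j) -fps_shiftD ![fps_shift j _ _]/fps_shift.
case: ltnP => // _; first exact: mderiv0.
exact: mderiv_exp_yt_zt.
Qed.

Lemma dy_is_linear j : linear (@dy R j).
Proof.
move=> a p q; elim: j => // j IHj.
by rewrite /dy !iterS -!/(dy j _) IHj mderivD mderivZ.
Qed.

HB.instance Definition _ j :=
  GRing.isLinear.Build R {mpoly R[3]} {mpoly R[3]} _ (@dy R j) (dy_is_linear j).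

Lemma M_LH_is_linear m r : linear (@M_LH R m r).
Proof.
move=> a p q; rewrite /M_LH !linearP /= !mulrDr -!scalerAr !scalerDr !scalerA.
by rewrite ![_ * a]mulrC; ring.
Qed.

HB.instance Definition _ m r :=
  GRing.isLinear.Build R {mpoly R[3]} {mpoly R[3]} _ (@M_LH R m r)
    (M_LH_is_linear m r).

Lemma M_LH_genfun m r n : (0 < m)%N -> (0 < r)%N ->
  fps_deriv (fps_mul (C m) (E r)) n = M_LH m r (fps_mul (C m) (E r) n).
Proof.
move=> m_gt0 r_gt0; rewrite fps_deriv_mul /M_LH !dy_fps_mul //.
rewrite [y * _ + _]addrC -addrA; congr (_ + _).
  (* The y-derivatives put t^(m-1) on the exponential; it is moved onto C_0, where the formula for
     C' expects it. *)
  rewrite -fps_mul_shiftC /fps_mul (raddf_sum (@Dxinv R)) scaler_sumr.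
  apply: eq_bigr => i _ /=.
  by rewrite fps_deriv_C0_xt // Dxinv_const_exp_yt_zt // scalerAl.
rewrite !mulr_sumr scaler_sumr -big_split; apply: eq_bigr => i _ /=.
rewrite fps_deriv_exp_yt_zt // mulrDr mulrCA; congr (_ + _).
by rewrite -scalerAr mulrCA.
Qed.

Lemma iter_M_LH m r n : (0 < m)%N -> (0 < r)%N ->
  iter n (M_LH m r) 1 = n`!%:R *: fps_mul (C m) (E r) n.
Proof.
move=> m_gt0 r_gt0; elim: n => [|n IHn].
  rewrite scale1r /fps_mul big_ord1 exp_yt_zt0 mulr1 (@C0_xt_wide _ _ 1) //.
  by rewrite big_ord1 muln0 /= expr1n invr1 scale1r mulm0n mpolyX0.
rewrite iterS IHn linearZ /= -M_LH_genfun // /fps_deriv factS mulnC natrM.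
by rewrite -scaler_nat scalerA.
Qed.
End GeneratingFunction.

(** * Appell polynomials on the monomial basis, and the generating function *)

Lemma appell_coef (R : numFieldType) (g : nat -> R) (A_ : nat -> {poly R}) n i :
  is_appell g A_ ->
  (A_ n)`_i =
    if (i <= n)%N then n`!%:R * (fps_inv (scalar_egf g) (n - i)%N / i`!%:R)
    else 0.
Proof.
move=> A_appell; have nf : n`!%:R != 0 :> R by rewrite pnatr_eq0 -lt0n fact_gt0.
have -> : A_ n = n`!%:R *: egf A_ n by rewrite /egf scalerA mulfV ?scale1r.
rewrite -A_appell coefZ /fps_mul coef_sum.
have expX j :
  fps_comp (exp_ser R) (fps_mono ('X : {poly R}) 1) j = (j`!%:R)^-1 *: 'X^j.
  rewrite /fps_comp (bigD1 ord_max) //= fps_exp_mono /fps_mono mul1n eqxx.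
  rewrite big1 ?addr0 // => k; rewrite -val_eqE /= eq_sym => /negbTE neq_k.
  by rewrite fps_exp_mono /fps_mono mul1n neq_k scaler0.
under eq_bigr => j _ do
  rewrite expX /fps_lift mulr_algl !coefZ coefXn.
case: leqP => [le_in | lt_ni]; last first.
  rewrite big1 ?mulr0 // => j _; rewrite gtn_eqF ?mulr0 //.
  exact: leq_ltn_trans (leq_subr _ _) lt_ni.
have lt_d : (n - i < n.+1)%N by rewrite ltnS leq_subr.
(* Since e^(xt) contributes x^(n-j)/(n-j)!, only j = n-i reaches x^i. *)
congr (_ * _); rewrite (bigD1 (Ordinal lt_d)) //= subKn // eqxx mulr1.
rewrite big1 ?addr0 // => j; rewrite -val_eqE /= => neq_j.
case: eqP => [def_i|_]; last by rewrite !mulr0.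
by move: neq_j; rewrite def_i subKn ?eqxx // -ltnS.
Qed.

(** Padding with zero coefficients lets the sum for A_n run over all i <= n from a mere degree
    bound. *)
Lemma poly_op_wide (R : numFieldType) (q : {poly R}) M (p : {mpoly R[3]}) N :
  (size q <= N)%N -> poly_op q M p = \sum_(i < N) q`_i *: iter i M p.
Proof.
move=> le_qN; rewrite /poly_op (big_ord_widen N (fun i => q`_i *: iter i M p)) //.
rewrite [RHS](bigID (fun i : 'I_N => (i < size q)%N)) /= [X in _ + X]big1 ?addr0 //.
by move=> i; rewrite -leqNgt => le_qi; rewrite nth_default ?scale0r.
Qed.

Theorem theorem2p1 (R : numFieldType) (m r : nat)
    (m_ge1 : (1 <= m)%N) (r_ge1 : (1 <= r)%N)
    (g : nat -> R) (g0_neq0 : g 0%N != 0)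
    (A : fps R) (A_def : A =1 fps_inv (scalar_egf g))
    (A_ : nat -> {poly R}) (A_appell : is_appell g A_) :
  fps_mul (fps_lift {mpoly R[3]} (fps_inv (scalar_egf g)))
          (fps_mul (C0_xt R m) (exp_yt_zt R r))
    =1 egf (LGH_appell m r A_)
  /\
  fps_mul (fps_lift {mpoly R[3]} A)
          (fps_mul (C0_xt R m) (exp_yt_zt R r))
    =1 egf (LGH_appell m r A_).
Proof.
have genfun : fps_mul (fps_lift {mpoly R[3]} (fps_inv (scalar_egf g)))
    (fps_mul (C0_xt R m) (exp_yt_zt R r)) =1 egf (LGH_appell m r A_).
  move=> n; rewrite /egf /LGH_appell (@poly_op_wide _ _ _ _ n.+1); last first.
    by apply/leq_sizeP => i lt_ni; rewrite (appell_coef _ _ A_appell) leqNgt lt_ni.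
  (* Reversing the Cauchy product pairs coefficient n-i of 1/g with coefficient i of the product,
     which is M^i 1 divided by i!. *)
  rewrite scaler_sumr [LHS](reindex_inj rev_ord_inj).
  apply: eq_bigr => i _ /=; have le_in : (i <= n)%N by rewrite -ltnS.
  rewrite subSS subKn // (appell_coef _ _ A_appell) le_in iter_M_LH // !scalerA.
  by rewrite /fps_lift mulr_algl mulKf ?divfK // pnatr_eq0 -lt0n fact_gt0 //.
split=> // n; rewrite -genfun; apply: eq_fps_mul => // i.
by rewrite /fps_lift A_def.
Qed.
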